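(* Assume the training observable $A:\mathbb{R}\to\mathbb{R}^{N_T}$ and the testing observable $O:\mathbb{R}\to\mathbb{R}$ are bounded. Then for every $r>0$ there is a constant $C=C(r)>0$ such that for all training observations $\boldsymbol{y}_1,\boldsymbol{y}_2\in\mathbb{R}^{N_T}$ with $\|\boldsymbol{y}_1\|_2,\|\boldsymbol{y}_2\|_2<r$, $$\left|\mathbb{E}_{\pi^{\boldsymbol{y}_1}}\overline O[\mathfrak{q}]-\mathbb{E}_{\pi^{\boldsymbol{y}_2}}\overline O[\mathfrak{q}]\right|\le C\,\|\boldsymbol{y}_1-\boldsymbol{y}_2\|_2,$$ where $\overline O[\mathfrak{q}]=\frac1\beta\int_0^\beta O(\mathfrak{q}(\tau))\,d\tau$ and $\pi^{\boldsymbol{y}}(d\mathfrak{q})=\int_{W^{\boldsymbol 1}}\mu^{\boldsymbol{y}}(dV)\,\pi^{V}(d\mathfrak{q})$.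
   Context: Fix $\beta>0$ (inverse temperature), $M>0$ (mass), $N_T\in\mathbb{N}$. Loop space: $X=\mathcal{L}\mathbb{R}$ is the space of (continuous) loops $\mathfrak{q}:[0,\beta]\to\mathbb{R}$ with $\mathfrak{q}(0)=\mathfrak{q}(\beta)$. Potential space: $V_o(x)=\frac12x^2$, $\mathring V=V-V_o$, and $W^{\boldsymbol 1}=\{V:\ V-V_o\in L^\infty(\mathbb{R})\cap L^2(\mathbb{R})\}$, normed by $\|V\|_{W^{\boldsymbol 1}}=\|V-V_o\|_{L^2}+\|V-V_o\|_{L^\infty}$ (i.e. $W^{\boldsymbol 1}$ is identified with $L^2\cap L^\infty$ via $V\mapsto V-V_o$). Gibbs measures on loops: $\pi_0$ is the probability measure on $X$ given formally by $\pi_0(d\mathfrak{q})\propto\exp\left(-\int_0^\beta[\frac M2|\dot{\mathfrak{q}}|^2+V_o(\mathfrak{q}(\tau))]d\tau\right)D[\mathfrak{q}]$, i.e. the centered Gaussian measure on continuous loops with covariance operator $\left(-M\frac{d^2}{d\tau^2}+1\right)^{-1}$ under periodic boundary conditions on $[0,\beta]$. For $V\in W^{\boldsymbol 1}$, $$\pi^V(d\mathfrak{q})=\frac1{\mathcal{Z}^V}\exp\left(-\int_0^\beta\mathring V(\mathfrak{q}(\tau))\,d\tau\right)\pi_0(d\mathfrak{q}),$$ with $\mathcal{Z}^V$ the normalizing constant. Prior on potentials: the Hermite functions are $\phi_n(x)=(-1)^n(2^nn!\sqrt\pi)^{-1/2}e^{x^2/2}\frac{d^n}{dx^n}e^{-x^2}$.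 $\mu_0$ is the law on $W^{\boldsymbol 1}$ of $V=V_o+\sum_{i\ge0}\gamma_i\xi_i\phi_i$, with $\xi_i$ i.i.d. $\mathcal{N}(0,1)$ and $\{\gamma_i\}$ a fixed real sequence with $\gamma_i=\mathcal{O}(i^{-s})$, $s>\max\{1,\frac{\theta+2}{4(1-\theta)}\}$ for a fixed $\theta\in(0,1)$. Observables: an observable is a measurable function $A$ of position; for loops $\overline A[\mathfrak{q}]=\frac1\beta\int_0^\beta A(\mathfrak{q}(\tau))d\tau$, and $G^A(V)=\mathbb{E}_{\pi^V}\overline A[\mathfrak{q}]$ (componentwise for vector-valued $A$). Posterior on potentials: $\Gamma_{\boldsymbol\eta}\in\mathbb{R}^{N_T\times N_T}$ is a fixed symmetric positive-definite matrix (noise covariance), $$\Phi(V;\boldsymbol{y})=\tfrac12\left\|\Gamma_{\boldsymbol\eta}^{-1/2}(\boldsymbol{y}-G^A(V))\right\|_2^2-\tfrac12\left\|\Gamma_{\boldsymbol\eta}^{-1/2}\boldsymbol{y}\right\|_2^2,$$ $$\mu^{\boldsymbol{y}}(dV)=\frac1{Z(\boldsymbol{y})}\exp(-\Phi(V;\boldsymbol{y}))\,\mu_0(dV),\qquad Z(\boldsymbol{y})=\int_{W^{\boldsymbol 1}}\exp(-\Phi(V;\boldsymbol{y}))\mu_0(dV).$$ *)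

(* Defs.v *)
From HB Require Import structures.
From mathcomp Require Import all_boot all_order all_algebra.
From mathcomp Require Import all_classical all_reals all_analysis.

Set Implicit Arguments.
Unset Strict Implicit.
Unset Printing Implicit Defensive.

Import Order.TTheory GRing.Theory Num.Theory.
Import numFieldNormedType.Exports.

Local Open Scope classical_set_scope.
Local Open Scope ring_scope.

Definition norm2 {R : realType} {n : nat} (v : 'cV[R]_n) : R :=
  Num.sqrt (\sum_i v i 0 ^+ 2).

Definition sym_posdef {R : realType} {n : nat} (G : 'M[R]_n) : Prop :=
  G^T = G /\ forall v : 'cV[R]_n, v != 0 -> 0 < (v^T *m G *m v) 0 0.

(* The square root of the inverse: the unique symmetric positive-definite S with
   S^2 = G^-1.  The default value 0 is irrelevant when G is symmetric
   positive-definite. *)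
Definition inv_sqrtmx {R : realType} {n : nat} (G : 'M[R]_n) : 'M[R]_n :=
  xget 0 [set S | sym_posdef S /\ S *m S = invmx G].

(* Expectation against a set function; P need not be packaged as a measure, so
   that measures given by formulas can be used directly. *)
Definition expectation_wrt {R : realType} {d : measure_display}
    {T : measurableType d} (P : set T -> \bar R) (f : T -> R) : R :=
  fine (\int[P]_x (f x)%:E)%E.

(* Loops [0, beta] -> R.  The value outside [0, beta] is junk, fixed to 0 so that
   a loop is determined by its values on [0, beta]. *)
Record loop (R : realType) (beta : R) := Loop {
  loop_fun :> R -> R ;
  loop_continuous : {within `[0, beta], continuous loop_fun} ;
  loop_closed : loop_fun 0 = loop_fun beta ;
  loop_out : forall t, t \notin `[0, beta] -> loop_fun t = 0 }.

Section loop_measurable.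
Context {R : realType} (beta : R).

Lemma loop0_continuous : {within `[0, beta], continuous (fun=> 0 : R)}.
Proof. by apply: continuous_subspaceT => x; exact: cvg_cst. Qed.

Definition loop0 : loop beta :=
  Loop loop0_continuous (erefl (0 : R)) (fun _ _ => erefl (0 : R)).

HB.instance Definition _ := gen_eqMixin (loop beta).
HB.instance Definition _ := gen_choiceMixin (loop beta).
HB.instance Definition _ := isPointed.Build (loop beta) loop0.

(* The cylinder sigma-algebra, which is also the Borel sigma-algebra of the
   uniform norm. *)
Definition loop_cylinders : set (set (loop beta)) :=
  [set C | exists t (B : set R), [/\ t \in `[0, beta], measurable B &
     C = [set q : loop beta | B (q t)]]].

HB.instance Definition _ := @isMeasurable.Build (sigma_display loop_cylinders)
  (loop beta) <<s loop_cylinders >> (@sigma_algebra0 _ setT loop_cylinders)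
  (@sigma_algebraC _ loop_cylinders)
  (@sigma_algebra_bigcup _ setT loop_cylinders).

End loop_measurable.

Definition time_average {R : realType} {beta : R} (f : R -> R) (q : loop beta) : R :=
  beta^-1 * (\int[lebesgue_measure]_(t in `[0, beta]) f (q t))%R.

Section free_loop_measure.
Context {R : realType} {beta : R}.

(* The variance 0 case is separated because [normal_prob m 0] is not a Dirac
   mass. *)
Definition centered_gaussian_law (s : R) (B : set R) : \bar R :=
  if s == 0 then dirac (0 : R) B else normal_prob 0 s B.

Definition centered_gaussian (pi0 : probability (loop beta) R) : Prop :=
  forall (n : nat) (c t : 'I_n -> R), (forall i, t i \in `[0, beta]) ->
  exists2 s : R, 0 <= s & forall B : set R, measurable B ->
    pi0 [set q : loop beta | B (\sum_i c i * q (t i))] = centered_gaussian_law s B.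

Definition loop_covariance (pi0 : probability (loop beta) R) (s t : R) : R :=
  expectation_wrt pi0 (fun q => q s * q t).

Definition covariance_operator (pi0 : probability (loop beta) R)
    (f : R -> R) (s : R) : R :=
  (\int[lebesgue_measure]_(t in `[0, beta]) (loop_covariance pi0 s t * f t))%R.

(* Periodic boundary conditions: C^2 functions on the circle of length beta. *)
Definition periodic_C2 (u : R -> R) : Prop :=
  [/\ forall t, u (t + beta) = u t,
      forall t, derivable u t 1,
      forall t, derivable (derive1 u) t 1 &
      continuous (derive1n 2 u)].

(* The covariance operator inverts -M d^2/dt^2 + 1 on periodic C^2 functions;
   since that operator maps them onto the continuous periodic functions, this
   determines the covariance, hence the centered Gaussian measure, uniquely. *)
Definition free_loop_measure (M : R) (pi0 : probability (loop beta) R) : Prop :=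
  centered_gaussian pi0 /\
  forall u, periodic_C2 u -> forall s, s \in `[0, beta] ->
    covariance_operator pi0 (fun t => - M * derive1n 2 u t + u t) s = u s.

End free_loop_measure.

Definition Vo {R : realType} (x : R) : R := x ^+ 2 / 2.

(* Potentials are functions rather than almost-everywhere classes: the
   pseudometric below identifies almost-everywhere equal ones, so the Borel
   sigma-algebra does not separate them. *)
Record W1 (R : realType) := MkW1 {
  W1_fun :> R -> R ;
  W1_L2 : (fun x => W1_fun x - Vo x) \in Lfun lebesgue_measure 2%:E ;
  W1_Loo : (fun x => W1_fun x - Vo x) \in Lfun lebesgue_measure +oo%E }.

Definition ring_pot {R : realType} (V : W1 R) (x : R) : R := V x - Vo x.

(* The norm of L^2 /\ L^oo, applied below to differences of potentials. *)
Definition norm_L2Loo {R : realType} (f : R -> R) : \bar R :=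
  ('N[lebesgue_measure]_(2%:E)[EFin \o f]
   + 'N[lebesgue_measure]_(+oo)[EFin \o f])%E.

Section W1_measurable.
Context {R : realType}.

Lemma VoB_Lfun (p : \bar R) : (1 <= p)%E ->
  (fun x : R => Vo x - Vo x) \in Lfun lebesgue_measure p.
Proof.
move=> p1; have -> : (fun x : R => Vo x - Vo x) = cst 0.
  by apply/funext => x; rewrite subrr.
rewrite inE; apply/andP; split; rewrite inE/=; first exact: measurable_cst.
exact: finite_norm_cst0.
Qed.

Lemma VoB_L2 : (fun x : R => Vo x - Vo x) \in Lfun lebesgue_measure 2%:E.
Proof. by apply: VoB_Lfun; rewrite lee_fin ler1n. Qed.

Lemma VoB_Loo : (fun x : R => Vo x - Vo x) \in Lfun lebesgue_measure +oo%E.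
Proof. by apply: VoB_Lfun; rewrite leey. Qed.

Definition W1_Vo : W1 R := MkW1 VoB_L2 VoB_Loo.

HB.instance Definition _ := gen_eqMixin (W1 R).
HB.instance Definition _ := gen_choiceMixin (W1 R).
HB.instance Definition _ := isPointed.Build (W1 R) W1_Vo.

Definition W1_open : set (set (W1 R)) :=
  [set U | forall V : W1 R, U V -> exists2 e : R, 0 < e &
     forall V' : W1 R, (norm_L2Loo (fun x => (V' x - V x)%R) < e%:E)%E -> U V'].

HB.instance Definition _ := @isMeasurable.Build (sigma_display W1_open)
  (W1 R) <<s W1_open >> (@sigma_algebra0 _ setT W1_open)
  (@sigma_algebraC _ W1_open) (@sigma_algebra_bigcup _ setT W1_open).

End W1_measurable.

Section prior.
Context {R : realType}.

Definition hermite (n : nat) (x : R) : R :=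
  (-1) ^+ n / Num.sqrt (2 ^+ n * n`!%:R * Num.sqrt pi) * expR (x ^+ 2 / 2)
  * derive1n n (fun z : R => expR (- z ^+ 2)) x.

Definition mutually_independent {d : measure_display} {Omega : measurableType d}
    (P : probability Omega R) (xi : nat -> {RV P >-> R}) : Prop :=
  forall (J : seq nat) (B : nat -> set R), uniq J ->
    (forall i, measurable (B i)) ->
    P (\bigcap_(i in [set` J]) (xi i @^-1` B i)) =
    (\prod_(i <- J) P (xi i @^-1` B i))%E.

Definition iid_standard_normal {d : measure_display} {Omega : measurableType d}
    (P : probability Omega R) (xi : nat -> {RV P >-> R}) : Prop :=
  mutually_independent xi /\
  forall i (B : set R), measurable B -> distribution P (xi i) B = normal_prob 0 1 B.

(* The series defining V converges almost surely in L^2 /\ L^oo. *)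
Definition prior_law (gamma : nat -> R) (mu0 : probability (W1 R) R) : Prop :=
  exists (d : measure_display) (Omega : measurableType d)
    (P : probability Omega R) (xi : nat -> {RV P >-> R}) (V : Omega -> W1 R),
  [/\ iid_standard_normal xi,
      measurable_fun setT V,
      {ae P, forall w,
         norm_L2Loo (fun x =>
           (\sum_(i < n) gamma i * xi i w * hermite i x) - ring_pot (V w) x)
         @[n --> \oo] --> 0%E} &
      forall B : set (W1 R), measurable B -> mu0 B = P (V @^-1` B)].

End prior.

Section posterior.
Context {R : realType} {beta : R} {N : nat}.
Variables (pi0 : probability (loop beta) R) (mu0 : probability (W1 R) R).
Variables (A : R -> 'cV[R]_N) (Gamma : 'M[R]_N).

Definition gibbs_weight (V : W1 R) (q : loop beta) : R :=
  expR (- (\int[lebesgue_measure]_(t in `[0%R, beta]) ring_pot V (q t))%R).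

Definition gibbs_Z (V : W1 R) : R := expectation_wrt pi0 (gibbs_weight V).

Definition gibbs (V : W1 R) (B : set (loop beta)) : \bar R :=
  ((gibbs_Z V)^-1%:E * \int[pi0]_(q in B) (gibbs_weight V q)%:E)%E.

Definition forward (V : W1 R) : 'cV[R]_N :=
  \col_i expectation_wrt (gibbs V) (time_average (fun x => A x i 0)).

Definition misfit (y : 'cV[R]_N) (V : W1 R) : R :=
  2^-1 * norm2 (inv_sqrtmx Gamma *m (y - forward V)) ^+ 2
  - 2^-1 * norm2 (inv_sqrtmx Gamma *m y) ^+ 2.

Definition posterior_Z (y : 'cV[R]_N) : R :=
  expectation_wrt mu0 (fun V => expR (- misfit y V)).

Definition posterior (y : 'cV[R]_N) (B : set (W1 R)) : \bar R :=
  ((posterior_Z y)^-1%:E * \int[mu0]_(V in B) (expR (- misfit y V))%:E)%E.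

Definition posterior_loop (y : 'cV[R]_N) (B : set (loop beta)) : \bar R :=
  (\int[posterior y]_V gibbs V B)%E.

End posterior.

(* Main.v *)
Require Import Defs.
From HB Require Import structures.
From mathcomp Require Import all_boot all_order all_algebra.
From mathcomp Require Import finmap all_classical all_reals all_analysis.
From mathcomp Require Import ring lra.

Import Order.TTheory GRing.Theory Num.Theory.
Import numFieldNormedType.Exports.

Local Open Scope classical_set_scope.
Local Open Scope ring_scope.

(** The dependence on the data [y] enters only through the misfit, so the whole
    statement reduces to how the posterior reacts to a change of potential
    function in an exponential tilt.

    Writing [S] for the inverse square root of the noise covariance and [F] for
    the forward map, expanding the square gives
      misfit y V = |S F(V)|^2 / 2 - <S y, S F(V)>.
    Since the observable is bounded, so is [F], uniformly in [V]: each [gibbs V]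
    has mass at most one.  Hence for |y| < r the misfit is bounded by some [K]
    ([misfit_bounded]) and it is Lipschitz in [y], with a constant [L] independent
    of [V] ([misfit_lipschitz]).

    Let |misfit y1 - misfit y2| <= t everywhere.  The weight exp(- misfit) changes
    by a factor at most exp t, and so does its integral, the normalizing constant;
    therefore each posterior is bounded by exp(2 t) times the other, set by set
    ([tilt_le]).  Such a mutual multiplicative bound survives mixing over [V] and
    integrating any nonnegative function.  The same lemma with the zero potential
    in place of one of the misfits bounds the posterior by exp(2 K) times the
    prior, so the integrals of the positive and negative parts of the time average
    of [O] are at most exp(2 K) sup |O|.  Two numbers below [b], each at most rho
    times the other, differ by at most (rho - 1) b ([mutual_ratio_le]); adding the
    two parts gives [mixture_tilt_lipschitz].  Taking t to be the smaller of
    L |y1 - y2| and 2 K turns exp(2 t) - 1 into a multiple of |y1 - y2|.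

    The measures at stake are set functions given by formulas, so the integral
    against them is used through its definition, for nonnegative integrands, as
    the supremum of the integrals of the simple functions below.  The argument
    needs only order properties of that supremum: monotonicity in the integrand
    and in the set function, and superadditivity.  For set functions themselves
    the corresponding property is [superadditive], which Gibbs measures and their
    mixtures inherit from the superadditivity of the integral
    ([lower_integralD]). *)

(** * Lower integrals against superadditive set functions *)

Section lower_integral.
Local Open Scope ereal_scope.
Context {R : realType} {d : measure_display} {T : measurableType d}.
Import HBNNSimple.

Definition positive_setfun (m : set T -> \bar R) : Prop :=
  m set0 = 0 /\ forall B, 0 <= m B.

(** What is left of finite additivity for a set function of the form
    [fun B => \int[mu]_(x in B) f x], where the integral is a supremum over simple
    functions: it still bounds the total mass of any finite partition. *)
Definition superadditive (m : set T -> \bar R) : Prop :=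
  positive_setfun m /\
  forall B C, measurable B -> measurable C -> B `&` C = set0 ->
    m B + m C <= m (B `|` C).

(** Simple integrals are sums over all reals, with finitely many nonzero terms
    only because values that are not attained contribute the mass of the empty
    set. *)
Lemma sintegral_rangeE (m : set T -> \bar R) (h : {nnsfun T >-> R}) :
  m set0 = 0 ->
  sintegral m h = \sum_(x \in range h) x%:E * m (h @^-1` [set x]).
Proof.
move=> m0; rewrite /sintegral (fsbig_widen (range h) setT)//= => x [_ Nhx] /=.
by rewrite preimage10// m0 mule0.
Qed.

Lemma setfun_sintegral_ge0 {m : set T -> \bar R} (h : {nnsfun T >-> R}) :
  positive_setfun m -> 0 <= sintegral m h.
Proof.
move=> [m0 mge0]; rewrite sintegral_rangeE//; apply: fsume_ge0 => _ [x _ <-].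
by rewrite mule_ge0// lee_fin.
Qed.

Lemma sup_sintegral_le0 {m : set T -> \bar R} : positive_setfun m ->
  ereal_sup [set sintegral m h |
    h in [set h : {nnsfun T >-> R} | forall x, (h x)%:E <= 0]] = 0.
Proof.
move=> pm; apply/eqP; rewrite eq_le; apply/andP; split.
- apply: ge_ereal_sup => _ [h /= h0 <-].
  rewrite sintegral_rangeE ?pm.1// fsbig1// => _ [x _ <-].
  suff -> : h x = 0%R by rewrite mul0e.
  by apply/eqP; rewrite eq_le -2!lee_fin h0 lee_fin/=.
- rewrite (le_trans (setfun_sintegral_ge0 (@nnsfun0 _ T R) pm))//.
  by apply: ereal_sup_ubound; exists nnsfun0.
Qed.

Lemma setfun_ge0_integralE {m : set T -> \bar R} (f : T -> \bar R) :
  positive_setfun m -> (forall x, 0 <= f x) ->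
  \int[m]_x f x = ereal_sup [set sintegral m h |
    h in [set h : {nnsfun T >-> R} | forall x, (h x)%:E <= f x]].
Proof.
move=> pm f0; rewrite /integral !patch_setT.
have -> : (f ^\+)%E = f.
  by apply/funext => x; apply: (@ge0_funeposE _ _ setT) => //; rewrite inE.
have -> : (f ^\-)%E = cst 0.
  by apply/funext => x; apply: (@ge0_funenegE _ _ setT) => //; rewrite inE.
rewrite [X in _ - X](_ : _ = 0) ?sube0//.
exact: sup_sintegral_le0.
Qed.

Lemma setfun_integral0 {m : set T -> \bar R} :
  positive_setfun m -> \int[m]_x cst 0 x = 0.
Proof.
by move=> pm; rewrite setfun_ge0_integralE//; exact: sup_sintegral_le0.
Qed.

Lemma setfun_integral_ge0 {m : set T -> \bar R} (f : T -> \bar R) :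
  positive_setfun m -> (forall x, 0 <= f x) -> 0 <= \int[m]_x f x.
Proof.
move=> pm f0; rewrite setfun_ge0_integralE//.
rewrite (le_trans (setfun_sintegral_ge0 (@nnsfun0 _ T R) pm))//.
by apply: ereal_sup_ubound; exists nnsfun0.
Qed.

Lemma superadditive_sum {m : set T -> \bar R} (h : {nnsfun T >-> R})
    (s : seq R) : superadditive m -> uniq s ->
  \sum_(x <- s) m (h @^-1` [set x]) <= m (h @^-1` [set` s]).
Proof.
move=> [[m0 mge0] mU]; elim: s => [|x s IH] /=.
  by rewrite big_nil.
move=> /andP[xs us]; rewrite big_cons.
have -> : h @^-1` [set` x :: s] = h @^-1` [set x] `|` h @^-1` [set` s].
  apply/seteqP; split => t /=; rewrite in_cons.
    by move=> /orP[/eqP|]; [left|right].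
  by move=> [->|->]; rewrite ?eqxx ?orbT.
rewrite (le_trans (leeD2l _ (IH us)))//.
have hs : h @^-1` [set` s] = \big[setU/set0]_(y <- s) (h @^-1` [set y]).
  rewrite -bigcup_seq; apply/seteqP; split => t /=.
    by move=> ht; exists (h t).
  by move=> [y /= ys ->].
apply: mU => //.
  by rewrite hs; apply: bigsetU_measurable => y _.
by apply/seteqP; split => // t [/= -> ]; rewrite (negbTE xs).
Qed.

(** The level sets of a simple function form a finite partition, so by
    superadditivity their masses add up to at most that of the whole space. *)
Lemma setfun_integral_le_mass {m : set T -> \bar R} (f : T -> \bar R) (c : R) :
  superadditive m -> m setT <= 1 -> (0 <= c)%R ->
  (forall x, 0 <= f x <= c%:E) -> \int[m]_x f x <= c%:E.
Proof.
move=> sm m1 c0 fc; have [pm _] := sm; have [m0 mge0] := pm.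
rewrite setfun_ge0_integralE//; last by move=> x; case/andP: (fc x).
apply: ge_ereal_sup => _ [h /= hf <-].
rewrite sintegral_rangeE// fsbig_finite//=.
have hU : h @^-1` [set` fset_set (range h)] = setT.
  by apply/seteqP; split => // t _ /=; rewrite in_fset_set// mem_set//; exists t.
apply: (@le_trans _ _
  (c%:E * \sum_(x <- fset_set (range h)) m (h @^-1` [set x]))).
  rewrite ge0_sume_distrr//; rewrite big_seq [leRHS]big_seq; apply: lee_sum => x.
  rewrite in_fset_set// inE => -[t _ <-].
  by rewrite lee_wpmul2r// (le_trans (hf t))//; case/andP: (fc t).
rewrite -[leRHS]mule1 lee_wpmul2l//.
rewrite (le_trans (superadditive_sum h _ sm (fset_uniq _)))//.
by rewrite hU.
Qed.

Lemma setfun_le_integral {m1 m2 : set T -> \bar R} (c : R) (f : T -> \bar R) :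
  positive_setfun m1 -> positive_setfun m2 -> (0 <= c)%R ->
  (forall B, measurable B -> m1 B <= c%:E * m2 B) -> (forall x, 0 <= f x) ->
  \int[m1]_x f x <= c%:E * \int[m2]_x f x.
Proof.
move=> p1 p2 c0 m12 f0; rewrite !setfun_ge0_integralE//.
apply: ge_ereal_sup => _ [h /= hf <-].
apply: (@le_trans _ _ (c%:E * sintegral m2 h)); last first.
  by rewrite lee_wpmul2l//; apply: ereal_sup_ubound; exists h.
rewrite !sintegral_rangeE ?p1.1 ?p2.1// !fsbig_finite//=.
rewrite big_seq [in leRHS]big_seq ge0_sume_distrr; last first.
  move=> x; rewrite in_fset_set// inE => -[t _ <-].
  by rewrite mule_ge0 ?lee_fin ?p2.2.
apply: lee_sum => x.
rewrite in_fset_set// inE => -[t _ <-].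
by rewrite muleCA lee_wpmul2l ?lee_fin// m12.
Qed.

(** If [h] is simple and below [f], then [c^-1 * h] is simple and below [g]; the
    integrands never have to be approximated. *)
Lemma ge0_le_lower_integral {mu : {measure set T -> \bar R}} {D : set T}
    {f g : T -> \bar R} (c : R) :
  (0 < c)%R -> (forall x, D x -> 0 <= f x) ->
  (forall x, D x -> f x <= c%:E * g x) ->
  \int[mu]_(x in D) f x <= c%:E * \int[mu]_(x in D) g x.
Proof.
move=> c0 f0 fg.
have g0 x : D x -> 0 <= g x.
  move=> Dx; rewrite -(pmule_rge0 _ (_ : 0 < c%:E)) ?lte_fin//.
  exact: le_trans (f0 _ Dx) (fg _ Dx).
rewrite !ge0_integralE//; apply: ge_ereal_sup => _ [h /= hf <-].
have ci0 : (0 <= c^-1)%R by rewrite invr_ge0 ltW.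
have -> : sintegral mu h = c%:E * sintegral mu (scale_nnsfun h ci0).
  rewrite sintegralrM muleA -EFinM divff ?mul1e// gt_eqF//.
rewrite lee_wpmul2l//; first by rewrite lee_fin ltW.
apply: ereal_sup_ubound => /=.
exists (scale_nnsfun h ci0) => //= x.
rewrite EFinM -lee_pdivlMl ?invr_gt0// invrK (le_trans (hf x))// /patch.
by case: ifPn; rewrite ?mule0// inE => /fg.
Qed.

(** A simple function below [f] plus one below [g] is a simple function below
    [f + g]. *)
Lemma lower_integralD {mu : {measure set T -> \bar R}} {f g : T -> \bar R} :
  (forall x, 0 <= f x) -> (forall x, 0 <= g x) ->
  \int[mu]_x f x + \int[mu]_x g x <= \int[mu]_x (f x + g x).
Proof.
move=> f0 g0; have fg0 x : 0 <= f x + g x by rewrite adde_ge0.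
have [->|] := eqVneq (\int[mu]_x (f x + g x)) +oo; first by rewrite leey.
rewrite -ltey => fgoo.
have le1 (u v : T -> \bar R) : (forall x, 0 <= u x <= v x) ->
    \int[mu]_x u x <= \int[mu]_x v x.
  move=> uv; rewrite -[leRHS]mul1e; apply: ge0_le_lower_integral => // x _.
    by case/andP: (uv x).
  by rewrite mul1e; case/andP: (uv x).
(* Finite integrals can be moved across the inequality, so that the two suprema
   are bounded one after the other. *)
have ffin : \int[mu]_x f x \is a fin_num.
  rewrite ge0_fin_numE ?integral_ge0//; apply: le_lt_trans fgoo.
  by apply: le1 => x; rewrite f0 leeDl.
have gfin : \int[mu]_x g x \is a fin_num.
  rewrite ge0_fin_numE ?integral_ge0//; apply: le_lt_trans fgoo.
  by apply: le1 => x; rewrite g0 leeDr.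
rewrite -leeBrDr// ge0_integralTE//; apply: ge_ereal_sup => _ [h /= hf <-].
rewrite leeBrDr// addeC.
have hfin : sintegral mu h \is a fin_num.
  rewrite ge0_fin_numE ?sintegral_ge0//.
  rewrite ge0_fin_numE ?integral_ge0// in ffin.
  apply: le_lt_trans ffin.
  by rewrite ge0_integralTE//; apply: ereal_sup_ubound; exists h.
rewrite -leeBrDr// [leLHS]ge0_integralTE//; apply: ge_ereal_sup => _ [k /= kg <-].
rewrite leeBrDr// addeC -sintegralD// ge0_integralTE//.
apply: ereal_sup_ubound; exists (add_nnsfun h k) => //= x.
by rewrite EFinD leeD.
Qed.

End lower_integral.

(** * Comparing expectations *)

Section expectation_bounds.
Local Open Scope ereal_scope.
Context {R : realType} {d : measure_display} {T : measurableType d}.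

Lemma fineB_le_norm (a b : \bar R) (c : R) :
  0 <= a <= c%:E -> 0 <= b <= c%:E -> (`|fine (a - b)| <= c)%R.
Proof.
case: a => [a| |]; rewrite ?leye_eq ?andbF//=.
case: b => [b| |]; rewrite ?leye_eq ?andbF//=.
rewrite !lee_fin => /andP[a0 ac] /andP[b0 bc]; rewrite ler_norml; lra.
Qed.

Lemma funepos_le_norm (f : T -> R) (c : R) : (forall x, `|f x| <= c)%R ->
  forall x, 0 <= (EFin \o f)^\+ x <= c%:E.
Proof.
move=> fc x; rewrite funepos_ge0 /= funeposE /= -EFin_max lee_fin ge_max.
by rewrite (le_trans (ler_norm _) (fc x)) (le_trans (normr_ge0 _) (fc x)).
Qed.

Lemma funeneg_le_norm (f : T -> R) (c : R) : (forall x, `|f x| <= c)%R ->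
  forall x, 0 <= (EFin \o f)^\- x <= c%:E.
Proof.
move=> fc x; rewrite funeneg_ge0 /= funenegE /= -EFin_max lee_fin ge_max.
rewrite (le_trans _ (fc x)) 1?(le_trans (normr_ge0 _) (fc x))//.
by rewrite -normrN ler_norm.
Qed.

Lemma setfun_integralE {m : set T -> \bar R} (f : T -> \bar R) :
  positive_setfun m ->
  \int[m]_x f x = \int[m]_x f^\+ x - \int[m]_x f^\- x.
Proof.
move=> pm; rewrite (setfun_ge0_integralE f^\+)// (setfun_ge0_integralE f^\-)//.
by rewrite /integral patch_setT.
Qed.

Lemma norm_expectation_le {m : set T -> \bar R} (f : T -> R) (c : R) :
  superadditive m -> m setT <= 1 -> (0 <= c)%R -> (forall x, `|f x| <= c)%R ->
  (`|expectation_wrt m f| <= c)%R.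
Proof.
move=> sm m1 c0 fc; have [pm _] := sm.
rewrite /expectation_wrt setfun_integralE//; apply: fineB_le_norm.
- rewrite setfun_integral_ge0//=.
  by apply: setfun_integral_le_mass => //; apply: funepos_le_norm.
- rewrite setfun_integral_ge0//=.
  by apply: setfun_integral_le_mass => //; apply: funeneg_le_norm.
Qed.

(** If [a1 >= a2] then [a1 - a2 <= (rho - 1) * a2 <= (rho - 1) * b]. *)
Lemma mutual_ratio_le (rho b : R) (a1 a2 : \bar R) :
  0 <= a1 <= b%:E -> 0 <= a2 <= b%:E ->
  a1 <= rho%:E * a2 -> a2 <= rho%:E * a1 -> (1 <= rho)%R ->
  (`|fine a1 - fine a2| <= (rho - 1) * b)%R.
Proof.
case: a1 => [a| |]; rewrite ?leye_eq ?andbF//=.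
case: a2 => [a'| |]; rewrite ?leye_eq ?andbF//=.
rewrite -!EFinM !lee_fin => /andP[a0 ac] /andP[b0 bc] h1 h2 r1; rewrite ler_norml.
have := @ler_wpM2l _ (rho - 1)%R _ _ _ ac.
have := @ler_wpM2l _ (rho - 1)%R _ _ _ bc.
by rewrite subr_ge0 => /(_ r1) e1 /(_ r1) e2; lra.
Qed.

(** The common dominating set function [nu] makes the integrals of the positive
    and negative parts finite, hence the expectations genuine differences, and
    turns the relative error [rho - 1] into an absolute one. *)
Lemma expectation_diff_le {m1 m2 nu : set T -> \bar R} (f : T -> R) (c k rho : R) :
  positive_setfun m1 -> positive_setfun m2 -> superadditive nu -> nu setT <= 1 ->
  (0 <= c)%R -> (0 <= k)%R -> (1 <= rho)%R ->
  (forall B, measurable B -> m1 B <= k%:E * nu B) ->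
  (forall B, measurable B -> m2 B <= k%:E * nu B) ->
  (forall B, measurable B -> m1 B <= rho%:E * m2 B) ->
  (forall B, measurable B -> m2 B <= rho%:E * m1 B) ->
  (forall x, `|f x| <= c)%R ->
  (`|expectation_wrt m1 f - expectation_wrt m2 f| <= 2 * (rho - 1) * (k * c))%R.
Proof.
move=> p1 p2 sn n1 c0 k0 rho1 m1n m2n m12 m21 fc; have [pn _] := sn.
have rho0 : (0 <= rho)%R by rewrite (le_trans _ rho1).
have bound m (pm : positive_setfun m) (g : T -> \bar R) :
    (forall B, measurable B -> m B <= k%:E * nu B) ->
    (forall x, 0 <= g x <= c%:E) -> 0 <= \int[m]_x g x <= (k * c)%:E.
  move=> mn gc; have g0 x : 0 <= g x by case/andP: (gc x).
  rewrite setfun_integral_ge0//=.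
  rewrite (le_trans (setfun_le_integral k g pm pn k0 mn g0))//.
  by rewrite EFinM lee_wpmul2l//; apply: setfun_integral_le_mass.
have diff (g : T -> \bar R) : (forall x, 0 <= g x <= c%:E) ->
    (`|fine (\int[m1]_x g x) - fine (\int[m2]_x g x)| <= (rho - 1) * (k * c))%R.
  move=> gc; have g0 x : 0 <= g x by case/andP: (gc x).
  by apply: mutual_ratio_le => //; [exact: bound|exact: bound|
    exact: setfun_le_integral|exact: setfun_le_integral].
have fin m (pm : positive_setfun m) (g : T -> \bar R) :
    (forall B, measurable B -> m B <= k%:E * nu B) ->
    (forall x, 0 <= g x <= c%:E) -> \int[m]_x g x \is a fin_num.
  move=> mn gc; have /andP[i0 ic] := bound m pm g mn gc.
  by rewrite ge0_fin_numE// (le_lt_trans ic)// ltry.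
have fp := funepos_le_norm f c fc; have fn := funeneg_le_norm f c fc.
rewrite /expectation_wrt !(setfun_integralE (fun x => (f x)%:E))//.
rewrite (fineB (fin _ p1 _ m1n fp) (fin _ p1 _ m1n fn)).
rewrite (fineB (fin _ p2 _ m2n fp) (fin _ p2 _ m2n fn)).
have := diff _ fp; have := diff _ fn; rewrite !ler_norml.
by move=> /andP[? ?] /andP[? ?]; apply/andP; split; lra.
Qed.

End expectation_bounds.

(** * Exponential tilts *)

Section tilting.
Local Open Scope ereal_scope.
Context {R : realType} {d : measure_display} {T : measurableType d}.
Variable mu : probability T R.

(** Both the Gibbs measures (tilting [pi0]) and the posterior (tilting [mu0]) are
    of this form. *)
Definition tilt (phi : T -> R) (B : set T) : \bar R :=
  (expectation_wrt mu (fun x => expR (- phi x)%R))^-1%:E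
  * \int[mu]_(x in B) (expR (- phi x)%R)%:E.

Lemma expectation_expR_ge0 (phi : T -> R) :
  (0 <= expectation_wrt mu (fun x => expR (- phi x)))%R.
Proof.
by apply: fine_ge0; apply: integral_ge0 => x _; rewrite lee_fin expR_ge0.
Qed.

Lemma tilt_superadditive (phi : T -> R) : superadditive (tilt phi).
Proof.
have Zi0 : 0 <= (expectation_wrt mu (fun x => expR (- phi x)%R))^-1%:E.
  by rewrite lee_fin invr_ge0 expectation_expR_ge0.
have w0 (B : set T) x : 0 <= ((fun x => (expR (- phi x)%R)%:E) \_ B) x.
  by rewrite /patch; case: ifPn => // _; rewrite lee_fin expR_ge0.
split; [split=> [|B]|move=> B C mB mC BC].
- by rewrite /tilt integral0_eq ?mule0.
- by rewrite mule_ge0// integral_ge0// => x _; rewrite lee_fin expR_ge0.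
rewrite /tilt -ge0_muleDr;
  [|by apply: integral_ge0 => x _; rewrite lee_fin expR_ge0..].
rewrite lee_wpmul2l// integral_mkcond [X in _ + X]integral_mkcond.
rewrite [leRHS]integral_mkcond.
rewrite (le_trans (lower_integralD (w0 B) (w0 C)))//.
rewrite le_eqVlt; apply/orP; left; apply/eqP; apply: eq_integral => x _.
rewrite /patch in_setU; have [xB|xB] := boolP (x \in B);
  have [xC|xC] := boolP (x \in C); rewrite ?adde0 ?add0e//.
have : (B `&` C) x by split; exact: set_mem.
by rewrite BC.
Qed.

(** If the weight has an infinite integral, then [fine] makes the normalizing
    constant [0], and the tilt is identically zero. *)
Lemma tilt_mass_le1 (phi : T -> R) : tilt phi setT <= 1.
Proof.
rewrite /tilt /expectation_wrt.
have : 0 <= \int[mu]_x (expR (- phi x))%:E.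
  by apply: integral_ge0 => x _; rewrite lee_fin expR_ge0.
case: (\int[mu]_x (expR (- phi x))%:E) => [z| |]//=; last first.
  by rewrite invr0 mul0e.
rewrite lee_fin => z0; have [->|zn0] := eqVneq z 0%R; first by rewrite mule0.
by rewrite -EFinM mulVf.
Qed.

(** One factor [expR t] comes from the weight and one from the normalizing
    constant. The bound [K] guarantees that the latter is positive and finite. *)
Lemma tilt_le (phi1 phi2 : T -> R) (K t : R) :
  (forall x, `|phi1 x| <= K)%R -> (forall x, `|phi2 x| <= K)%R ->
  (forall x, `|phi1 x - phi2 x| <= t)%R ->
  forall B, tilt phi1 B <= (expR (2 * t))%:E * tilt phi2 B.
Proof.
move=> b1 b2 b12 B.
have w0 phi (D : set T) x : D x -> 0 <= (expR (- phi x)%R)%:E :> \bar R.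
  by rewrite lee_fin expR_ge0.
have shift (p q : T -> R) (D : set T) : (forall x, `|p x - q x| <= t)%R ->
    \int[mu]_(x in D) (expR (- p x)%R)%:E
    <= (expR t)%:E * \int[mu]_(x in D) (expR (- q x)%R)%:E.
  move=> pq; apply: ge0_le_lower_integral => [|x Dx|x _]; rewrite ?expR_gt0//.
  rewrite -EFinM -expRD lee_fin ler_expR.
  by have := pq x; rewrite ler_norml => /andP[? ?]; lra.
have Zfin p : (forall x, `|p x| <= K)%R ->
    exists2 z : R, (0 < z)%R & \int[mu]_x (expR (- p x)%R)%:E = z%:E.
  move=> pK.
  have up : \int[mu]_x (expR (- p x)%R)%:E <= (expR K)%:E * \int[mu]_x 1.
    apply: ge0_le_lower_integral => [|x Dx|x _]; rewrite ?expR_gt0//.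
    rewrite mule1 lee_fin ler_expR.
    by have := pK x; rewrite ler_norml => /andP[? ?]; lra.
  have lo : \int[mu]_x 1 <= (expR K)%:E * \int[mu]_x (expR (- p x)%R)%:E.
    apply: ge0_le_lower_integral => [|x Dx|x _]; rewrite ?expR_gt0//.
    rewrite -EFinM -expRD lee_fin -[leLHS]expR0 ler_expR.
    by have := pK x; rewrite ler_norml => /andP[? ?]; lra.
  move: up lo; rewrite integral_cst//= probability_setT !mule1.
  case: (\int[mu]_x (expR (- p x))%:E) => [z| |]//=.
    rewrite -EFinM !lee_fin => _ h; exists z => //.
    by rewrite -(pmulr_rgt0 _ (expR_gt0 K)) (lt_le_trans _ h).
  by rewrite gt0_muleNy ?lte_fin ?expR_gt0.
have [z1 z10 Z1] := Zfin _ b1; have [z2 z20 Z2] := Zfin _ b2.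
rewrite /tilt /expectation_wrt Z1 Z2 /=.
have b21 x : (`|phi2 x - phi1 x| <= t)%R by rewrite distrC.
have := shift _ _ setT b21; rewrite Z1 Z2 -EFinM lee_fin => z21.
set I2 := \int[mu]_(x in B) (expR (- phi2 x)%R)%:E.
have -> : (expR (2 * t))%:E * (z2^-1%:E * I2)
        = (expR t * z2^-1)%:E * ((expR t)%:E * I2).
  rewrite !muleA -!EFinM; congr (_%:E * _).
  by rewrite mulrAC -expRD; congr (expR _ * _)%R; ring.
apply: lee_pmul.
- by rewrite lee_fin invr_ge0 ltW.
- by apply: integral_ge0 => x; exact: w0.
- by rewrite lee_fin ler_pdivlMr// ler_pdivrMl// mulrC.
- exact: shift.
Qed.

End tilting.

(** * Mixtures *)

Section mixture.
Local Open Scope ereal_scope.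
Context {R : realType} {d1 d2 : measure_display}.
Context {S : measurableType d1} {T : measurableType d2}.
Variable k : S -> set T -> \bar R.
Hypothesis k_super : forall v, superadditive (k v).
Hypothesis k_mass : forall v, k v setT <= 1.

Definition mixture (nu : set S -> \bar R) (B : set T) : \bar R :=
  \int[nu]_v k v B.

Lemma mixture_positive {nu : set S -> \bar R} :
  positive_setfun nu -> positive_setfun (mixture nu).
Proof.
move=> pn; split=> [|B]; last first.
  by apply: setfun_integral_ge0 => // v; apply: (k_super v).1.2.
have k0 v : k v set0 = 0 by apply: (k_super v).1.1.
by rewrite /mixture (_ : k ^~ set0 = cst 0) ?setfun_integral0//; exact/funext.
Qed.

Lemma mixture_superadditive (mu : {measure set S -> \bar R}) :
  superadditive (mixture mu).
Proof.
have pm : positive_setfun (mu : set S -> \bar R) by split.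
split=> [|B C mB mC BC]; first exact: mixture_positive.
have k0 v D : 0 <= k v D by apply: (k_super v).1.2.
rewrite /mixture (le_trans (lower_integralD (k0 ^~ B) (k0 ^~ C)))//.
rewrite -[leRHS]mul1e; apply: ge0_le_lower_integral => // v _; rewrite ?adde_ge0//.
by rewrite mul1e; apply: (k_super v).2.
Qed.

Lemma mixture_mass_le1 (mu : probability S R) : mixture mu setT <= 1.
Proof.
have -> : 1 = 1%:E * \int[mu]_v 1.
  by rewrite integral_cst//= probability_setT !mule1.
apply: ge0_le_lower_integral => // v _; first exact: (k_super v).1.2.
by rewrite mule1.
Qed.

(** The set function that dominates both mixtures is the one obtained from [mu]
    itself, which is the tilt by the zero potential. *)
Lemma mixture_tilt_lipschitz (mu : probability S R) (phi1 phi2 : S -> R)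
    (f : T -> R) (c K t : R) :
  (0 <= c)%R -> (0 <= t)%R -> (forall x, `|f x| <= c)%R ->
  (forall v, `|phi1 v| <= K)%R -> (forall v, `|phi2 v| <= K)%R ->
  (forall v, `|phi1 v - phi2 v| <= t)%R ->
  (`|expectation_wrt (mixture (tilt mu phi1)) f
     - expectation_wrt (mixture (tilt mu phi2)) f|
   <= 2 * (expR (2 * t) - 1) * (expR (2 * K) * c))%R.
Proof.
move=> c0 t0 fc b1 b2 b12.
have [pt1 _] := tilt_superadditive mu phi1.
have [pt2 _] := tilt_superadditive mu phi2.
have pm : positive_setfun (mu : set S -> \bar R) by split.
have k0 B v : 0 <= k v B by apply: (k_super v).1.2.
have K0 : (0 <= K)%R := le_trans (normr_ge0 _) (b1 point).
have tilt0 B : measurable B -> tilt mu (cst 0%R) B = mu B.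
  move=> mB; rewrite /tilt /expectation_wrt /= oppr0 expR0 !integral_cst//=.
  by rewrite probability_setT !mul1e invr1 mul1e.
have tilt_mu phi B : (forall v, `|phi v| <= K)%R -> measurable B ->
    tilt mu phi B <= (expR (2 * K))%:E * mu B.
  move=> bp mB; rewrite -tilt0//; apply: (tilt_le mu phi (cst 0%R) K K) => // v /=.
    by rewrite normr0.
  by rewrite subr0.
have mix_mu phi B : (forall v, `|phi v| <= K)%R -> measurable B ->
    mixture (tilt mu phi) B <= (expR (2 * K))%:E * mixture mu B.
  move=> bp mB; have [pt _] := tilt_superadditive mu phi.
  by apply: setfun_le_integral; rewrite ?expR_ge0// => D mD; exact: tilt_mu.
have mix_le p q B :
    (forall v, `|p v| <= K)%R -> (forall v, `|q v| <= K)%R ->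
    (forall v, `|p v - q v| <= t)%R ->
    mixture (tilt mu p) B <= (expR (2 * t))%:E * mixture (tilt mu q) B.
  move=> bp bq pq; have [ptp _] := tilt_superadditive mu p.
  have [ptq _] := tilt_superadditive mu q.
  by apply: setfun_le_integral; rewrite ?expR_ge0// => D mD;
    exact: (tilt_le mu p q K).
apply: (expectation_diff_le (nu := mixture mu)); rewrite ?expR_ge0//.
- exact: mixture_positive.
- exact: mixture_positive.
- exact: mixture_superadditive.
- exact: mixture_mass_le1.
- by rewrite -[leLHS]expR0 ler_expR; lra.
- by move=> B mB; exact: mix_mu.
- by move=> B mB; exact: mix_mu.
- by move=> B mB; exact: mix_le.
- by move=> B mB; apply: mix_le => // v; rewrite distrC.
Qed.

End mixture.

(** * Euclidean norms *)

Section euclidean.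
Context {R : realType}.

Lemma norm2_sqr {n : nat} (v : 'cV[R]_n) : norm2 v ^+ 2 = \sum_i v i 0 ^+ 2.
Proof. by rewrite sqr_sqrtr// sumr_ge0// => i _; exact: sqr_ge0. Qed.

Lemma norm2_ge0 {n : nat} (v : 'cV[R]_n) : 0 <= norm2 v.
Proof. exact: sqrtr_ge0. Qed.

Lemma coord_le_norm2 {n : nat} (v : 'cV[R]_n) i : `|v i 0| <= norm2 v.
Proof.
rewrite -(@ler_pXn2r _ 2)// ?nnegrE ?norm2_ge0// norm2_sqr real_normK ?num_real//.
by rewrite (bigD1 i)//= lerDl sumr_ge0// => j _; exact: sqr_ge0.
Qed.

Lemma coord_le_mx_norm {m n : nat} (M : 'M[R]_(m, n)) i j : `|M i j| <= `|M|.
Proof.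
by rewrite [leRHS]/Num.norm /= mx_normrE; apply/bigmax_geP; right; exists (i, j).
Qed.

Lemma ler_sum_const {n : nat} (F : 'I_n -> R) (c : R) :
  (forall i, F i <= c) -> \sum_i F i <= n%:R * c.
Proof.
move=> Fc; rewrite (le_trans (ler_sum _ (fun i _ => Fc i)))//.
by rewrite sumr_const card_ord mulr_natl.
Qed.

Lemma coord_mulmx_le {m n : nat} (M : 'M[R]_(m, n)) (v : 'cV[R]_n) (c : R) i :
  (forall j, `|v j 0| <= c) -> `|(M *m v) i 0| <= n%:R * `|M| * c.
Proof.
move=> vc; rewrite mxE (le_trans (ler_norm_sum _ _ _))//.
rewrite -mulrA; apply: ler_sum_const => j.
by rewrite normrM ler_pM// coord_le_mx_norm.
Qed.

(** Subtracting the data term leaves an expression affine in the data [u]; this is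
    why the misfit is Lipschitz in the data and bounded for bounded data. *)
Lemma quadratic_misfitE {n : nat} (u w : 'cV[R]_n) :
  2^-1 * norm2 (u - w) ^+ 2 - 2^-1 * norm2 u ^+ 2
  = \sum_i (2^-1 * w i 0 ^+ 2 - u i 0 * w i 0).
Proof.
rewrite !norm2_sqr -mulrBr -sumrB mulr_sumr; apply: eq_bigr => i _.
by rewrite !mxE; field.
Qed.

End euclidean.

(** * Gibbs measures, forward map and misfit *)

Section model.
Context {R : realType} {beta : R} {N : nat}.

Lemma bounded_fun_bound {V : normedModType R} (f : R -> V) :
  bounded_fun f -> exists2 c : R, 0 <= c & forall x, `|f x| <= c.
Proof.
move=> [c [_ fc]]; exists (`|c| + 1); first by rewrite addr_ge0.
by move=> x; apply: fc => //; rewrite (le_lt_trans (ler_norm _))// ltrDl.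
Qed.

Lemma norm_time_average_le (f : R -> R) (c : R) (q : loop beta) :
  0 < beta -> (forall x, `|f x| <= c) -> `|time_average f q| <= c.
Proof.
move=> b0 fc.
have c0 : 0 <= c by exact: le_trans (normr_ge0 _) (fc 0).
rewrite /time_average normrM normfV (gtr0_norm b0) ler_pdivrMl//.
rewrite /Rintegral integralE.
have bound (g : R -> \bar R) : (forall t, 0 <= g t <= c%:E)%E ->
    (0 <= \int[lebesgue_measure]_(t in `[0%R, beta]) g t <= (beta * c)%:E)%E.
  move=> gc; rewrite integral_ge0/=; last by move=> t _; case/andP: (gc t).
  have -> : (beta * c)%:E =
      (1%:E * \int[lebesgue_measure]_(t in `[0%R, beta]) c%:E)%E.
    rewrite integral_cst//= lebesgue_measure_itv/= lte_fin b0 mul1e.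
    by rewrite oppr0 adde0 muleC.
  apply: ge0_le_lower_integral => // t _; first by case/andP: (gc t).
  by rewrite mul1e; case/andP: (gc t).
apply: fineB_le_norm; apply: bound => t.
- exact: (funepos_le_norm (f \o q) c (fun s => fc (q s))).
- exact: (funeneg_le_norm (f \o q) c (fun s => fc (q s))).
Qed.

Variables (pi0 : probability (loop beta) R) (mu0 : probability (W1 R) R).
Variables (A : R -> 'cV[R]_N) (Gamma : 'M[R]_N).

Lemma gibbs_superadditive (V : W1 R) : superadditive (gibbs pi0 V).
Proof.
exact: (tilt_superadditive pi0 (fun q =>
  \int[lebesgue_measure]_(t in `[0%R, beta]) ring_pot V (q t))).
Qed.

Lemma gibbs_mass_le1 (V : W1 R) : (gibbs pi0 V setT <= 1)%E.
Proof.
exact: (tilt_mass_le1 pi0 (fun q =>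
  \int[lebesgue_measure]_(t in `[0%R, beta]) ring_pot V (q t))).
Qed.

Lemma norm_forward_le (a : R) (V : W1 R) i : 0 < beta ->
  (forall x, `|A x| <= a) -> `|forward pi0 A V i 0| <= a.
Proof.
move=> b0 Aa; rewrite mxE; apply: norm_expectation_le.
- exact: gibbs_superadditive.
- exact: gibbs_mass_le1.
- exact: le_trans (normr_ge0 _) (Aa 0).
- move=> q; apply: norm_time_average_le => // x.
  exact: le_trans (coord_le_mx_norm _ _ _) (Aa x).
Qed.

Lemma misfit_bounded (a r : R) : 0 < beta -> (forall x, `|A x| <= a) ->
  exists K, forall y V, norm2 y < r -> `|misfit pi0 A Gamma y V| <= K.
Proof.
move=> b0 Aa; set s := N%:R * `|inv_sqrtmx Gamma|.
exists (N%:R * (2^-1 * (s * a) ^+ 2 + s * r * (s * a))) => y V yr.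
rewrite /misfit mulmxBr quadratic_misfitE (le_trans (ler_norm_sum _ _ _))//.
apply: ler_sum_const => i; rewrite (le_trans (ler_normB _ _))// !normrM.
have Fs : `|(inv_sqrtmx Gamma *m forward pi0 A V) i 0| <= s * a.
  by apply: coord_mulmx_le => j; exact: norm_forward_le.
apply: lerD.
  by rewrite gtr0_norm ?invr_gt0// ler_wpM2l ?invr_ge0// ler_pM.
apply: ler_pM => //; apply: coord_mulmx_le => j.
by rewrite (le_trans (coord_le_norm2 _ _))// ltW.
Qed.

Lemma misfit_lipschitz (a : R) : 0 < beta -> (forall x, `|A x| <= a) ->
  exists2 L, 0 <= L & forall y1 y2 V,
    `|misfit pi0 A Gamma y1 V - misfit pi0 A Gamma y2 V| <= L * norm2 (y1 - y2).
Proof.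
move=> b0 Aa; set s := N%:R * `|inv_sqrtmx Gamma|.
have a0 : 0 <= a by exact: le_trans (normr_ge0 _) (Aa 0).
have s0 : 0 <= s by rewrite mulr_ge0.
exists (N%:R * (s * (s * a))); first by rewrite !mulr_ge0.
move=> y1 y2 V; rewrite /misfit !mulmxBr !quadratic_misfitE -sumrB.
rewrite (le_trans (ler_norm_sum _ _ _))// -mulrA; apply: ler_sum_const => i.
set w := (inv_sqrtmx Gamma *m forward pi0 A V) i 0.
rewrite [X in `|X|](_ : _ = - ((inv_sqrtmx Gamma *m (y1 - y2)) i 0 * w));
  last first.
  by rewrite mulmxBr !mxE; ring.
have -> : s * (s * a) * norm2 (y1 - y2) = (s * norm2 (y1 - y2)) * (s * a) by ring.
rewrite normrN normrM; apply: ler_pM => //; apply: coord_mulmx_le => j.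
  exact: coord_le_norm2.
exact: norm_forward_le.
Qed.

End model.

(** This is [1 - x <= expR (- x)] multiplied by [expR x]. *)
Lemma expR_subr1_le {R : realType} (x : R) : expR x - 1 <= x * expR x.
Proof.
have /(ler_wpM2l (expR_ge0 x)) := expR_ge1Dx (- x).
by rewrite expRxMexpNx_1 => h; lra.
Qed.

(** * Lipschitz dependence of the predictions on the data *)

Theorem corollary9 (R : realType) (beta M : R) (hbeta : 0 < beta) (hM : 0 < M)
  (pi0 : probability (loop beta) R) (hpi0 : free_loop_measure M pi0)
  (theta s : R) (htheta : 0 < theta < 1)
  (hs : Num.max 1 ((theta + 2) / (4 * (1 - theta))) < s)
  (gamma : nat -> R) (hgamma : gamma =O_\oo (fun i => i%:R `^ (- s)))
  (mu0 : probability (W1 R) R) (hmu0 : prior_law gamma mu0)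
  (N : nat) (Gamma : 'M[R]_N) (hGamma : sym_posdef Gamma)
  (A : R -> 'cV[R]_N) (mA : forall i, measurable_fun setT (fun x => A x i 0))
  (bA : bounded_fun A)
  (O : R -> R) (mO : measurable_fun setT O) (bO : bounded_fun O)
  (r : R) (hr : 0 < r) :
  exists2 C : R, 0 < C &
    forall y1 y2 : 'cV[R]_N, norm2 y1 < r -> norm2 y2 < r ->
      `| expectation_wrt (posterior_loop pi0 mu0 A Gamma y1) (time_average O)
         - expectation_wrt (posterior_loop pi0 mu0 A Gamma y2) (time_average O) |
      <= C * norm2 (y1 - y2).
Proof.
have [a a0 Aa] := bounded_fun_bound A bA.
have [c c0 Oc] := bounded_fun_bound O bO.
have [K mK] := misfit_bounded pi0 A Gamma a r hbeta Aa.
have [L L0 mL] := misfit_lipschitz pi0 A Gamma a hbeta Aa.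
exists (2 * (2 * L * expR (4 * K)) * (expR (2 * K) * c) + 1).
  by rewrite ltr_wpDl// !mulr_ge0// expR_ge0.
move=> y1 y2 y1r y2r; set D := norm2 _; have D0 : 0 <= D := norm2_ge0 _.
have K0 : 0 <= K := le_trans (normr_ge0 _) (mK y1 point y1r).
(* The first bound gives the factor [D]; the second keeps [expR (2 * t)] bounded
   independently of the data. *)
pose t := Num.min (L * D) (2 * K).
have t0 : 0 <= t by rewrite le_min !mulr_ge0.
have mt V : `|misfit pi0 A Gamma y1 V - misfit pi0 A Gamma y2 V| <= t.
  rewrite le_min mL/= (le_trans (ler_normB _ _))//.
  by rewrite mulr2n mulrDl mul1r lerD// mK.
have -> : posterior_loop pi0 mu0 A Gamma y1 =
  mixture (gibbs pi0) (tilt mu0 (misfit pi0 A Gamma y1)) by [].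
have -> : posterior_loop pi0 mu0 A Gamma y2 =
  mixture (gibbs pi0) (tilt mu0 (misfit pi0 A Gamma y2)) by [].
have := mixture_tilt_lipschitz (gibbs pi0) (gibbs_superadditive pi0)
  (gibbs_mass_le1 pi0) mu0 _ _ (time_average O) c K t c0 t0
  (fun q => norm_time_average_le O c q hbeta Oc)
  (fun V => mK y1 V y1r) (fun V => mK y2 V y2r) mt.
move=> /le_trans; apply.
have e2t : expR (2 * t) - 1 <= 2 * L * expR (4 * K) * D.
  rewrite (le_trans (expR_subr1_le _))//.
  have -> : 2 * L * expR (4 * K) * D = (2 * (L * D)) * expR (4 * K) by ring.
  rewrite ler_pM ?expR_ge0// ?mulr_ge0//.
    by rewrite ler_wpM2l// ge_min lexx.
  rewrite ler_expR; have : t <= 2 * K by rewrite ge_min lexx orbT.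
  lra.
have cE : 0 <= expR (2 * K) * c by rewrite mulr_ge0// expR_ge0.
rewrite [leRHS]mulrDl mul1r ler_wpDr//.
have -> : 2 * (2 * L * expR (4 * K)) * (expR (2 * K) * c) * D
  = 2 * (2 * L * expR (4 * K) * D) * (expR (2 * K) * c) by ring.
by rewrite ler_wpM2r// ler_wpM2l.
Qed.
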